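(* Let $f:[-1,1]\to\mathbb{R}$ and let the real-valued function $g(\cdot)=f(\cos\cdot)$ on $[0,\pi]$ satisfy the following conditions: (i) $g\in C[0,\pi]$; (ii) $\operatorname{supp}(g)\subset[0,\pi)$; (iii) the derivative from the right $g'(0)$ exists and is finite; (iv) $g$ is convex. Then $g$ is a positive definite function on $\mathbb{S}^1$. If, in addition to conditions (i), (ii), (iii) and (iv), $g$ restricted to $(0,\pi)$ does not reduce to a piecewise linear function with finitely many pieces, then $g$ is a strictly positive definite function on $\mathbb{S}^1$.
   Context: $\mathbb{S}^1$ is the unit circle in $\mathbb{R}^2$, with geodesic distance $d(x,y)=\arccos(x^Ty)$. A continuous function $g:[0,\pi]\to\mathbb{R}$ is (zonal) positive definite on $\mathbb{S}^1$ if for all $n\in\mathbb{N}$ and all sets of $n$ distinct points $x_1,\ldots,x_n\in\mathbb{S}^1$, the matrix $M_X=[g(d(x_i,x_j))]_{i,j=1}^n$ is positive semi-definite, i.e. $c^TM_Xc\ge 0$ for all $c\in\mathbb{R}^n$. It is strictly positive definite on $\mathbb{S}^1$ if all these matrices satisfy $c^TM_Xc>0$ for all nonzero $c\in\mathbb{R}^n$. The support $\operatorname{supp}(g)$ is the closure of $\{\theta\in[0,\pi]: g(\theta)\neq 0\}$, so (ii) means that $g$ vanishes identically in a neighbourhood of $\pi$. *)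

(* Defs.v *)
From HB Require Import structures.
From mathcomp Require Import all_boot all_order all_algebra.
From mathcomp Require Import all_classical all_reals all_analysis.
Set Implicit Arguments.
Unset Strict Implicit.
Unset Printing Implicit Defensive.
Import Order.TTheory GRing.Theory Num.Theory.
Import numFieldNormedType.Exports.
Local Open Scope classical_set_scope.
Local Open Scope ring_scope.

                                                                             
                                                              

Definition inner2 (R : realType) (x y : 'cV[R]_2) : R := (x^T *m y) 0 0.

                                                                              
                               
Definition circle (R : realType) : set 'cV[R]_2 := [set x | inner2 x x = 1].

Definition geodist (R : realType) (x y : 'cV[R]_2) : R := acos (inner2 x y).

Definition distmx (R : realType) (g : R -> R) (n : nat)
    (x : 'I_n -> 'cV[R]_2) : 'M[R]_n :=
  \matrix_(i, j) g (geodist (x i) (x j)).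

Definition qform (R : realType) (n : nat) (M : 'M[R]_n) (c : 'cV[R]_n) : R :=
  (c^T *m M *m c) 0 0.

Definition posdef_circle (R : realType) (g : R -> R) : Prop :=
  {within `[0, pi], continuous g} /\
  forall (n : nat) (x : 'I_n -> 'cV[R]_2),
    injective x -> (forall i, circle (x i)) ->
    forall c : 'cV[R]_n, 0 <= qform (distmx g x) c.

Definition strict_posdef_circle (R : realType) (g : R -> R) : Prop :=
  {within `[0, pi], continuous g} /\
  forall (n : nat) (x : 'I_n -> 'cV[R]_2),
    injective x -> (forall i, circle (x i)) ->
    forall c : 'cV[R]_n, c != 0 -> 0 < qform (distmx g x) c.

Definition supp (R : realType) (g : R -> R) : set R :=
  closure [set t | 0 <= t <= pi /\ g t != 0].

                                            
Definition right_derivable (R : realType) (g : R -> R) (a : R) : Prop :=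
  cvg ((g (a + h) - g a) / h @[h --> 0^'+]).

                                                                             
                                                                            
Definition piecewise_linear_oo (R : realType) (a b : R) (g : R -> R) : Prop :=
  exists2 s : seq R, path <%R a (rcons s b) &
    forall i : nat, (i <= size s)%N ->
      exists p q : R, forall t : R, a < t < b ->
        nth 0 (a :: rcons s b) i <= t <= nth 0 (a :: rcons s b) i.+1 ->
        g t = p * t + q.

(* Main.v *)
(**
The quadratic form of [g] at points x_1, ..., x_n only involves the values of
[g] at the finitely many distances d_ij, so [g] may be replaced by its
piecewise linear interpolant at any finite set of knots that contains them
and [pi]. Since [g] is convex and vanishes near [pi], that interpolant is a
combination, with nonnegative coefficients (the slope jumps), of the hinges
(t - d)_+ over the knots t. The hinge (t - d)_+ is the length of the
intersection of two arcs of length t <= pi whose origins are at distance d, so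
its quadratic form is the integral of F^2, where F is the step function summing
the indicators of these arcs with weights c_i. If c_i <> 0 and 0 < t < pi is
not one of the d_ij, then F has a jump c_i at x_i, and the form is positive. If
[g] is not piecewise linear, it leaves its chord at some t strictly between two
consecutive knots; adding t as a knot gives a hinge with a positive
coefficient. Integrals of step functions are taken as finite sums over a sorted
list of breakpoints.
*)
Require Import Defs.
From mathcomp Require Import all_boot all_order all_algebra.
From mathcomp Require Import all_classical all_reals all_analysis.
From mathcomp Require Import ring lra.
Import Order.TTheory GRing.Theory Num.Theory.
Import numFieldNormedType.Exports.
Local Open Scope classical_set_scope.
Local Open Scope ring_scope.

(** * Integrals of step functions and overlaps of arcs *)

(** A left Riemann sum: the exact integral of a step function that is constant on each cell from a
    breakpoint, included, to the next, excluded. *)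
Definition grid_sum {R : realType} (s : seq R) (phi : R -> R) : R :=
  \sum_(k < (size s).-1) (s`_k.+1 - s`_k) * phi s`_k.

(** Half-open, so that the value at a breakpoint is the value on the whole cell to its right, as
    [grid_sum] assumes. *)
Definition ico {R : realType} (l r z : R) : R := ((l <= z) && (z < r))%:R.

Lemma ico_mul (R : realType) (l r l' r' z : R) :
  ico l r z * ico l' r' z = ico (Num.max l l') (Num.min r r') z.
Proof. by rewrite /ico -natrM mulnb ge_max lt_min andbACA. Qed.

(** The nonzero terms run from the index of [l] to that of [r] and telescope; the maximum accounts
    for an empty interval. *)
Lemma grid_sum_ico (R : realType) (s : seq R) (l r : R) :
  sorted <%R s -> l \in s -> r \in s ->
  grid_sum s (ico l r) = Num.max 0 (r - l).
Proof.
move=> s_sorted ls rs; rewrite /grid_sum.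
have [a_lt b_lt] : (index l s < size s)%N /\ (index r s < size s)%N.
  by rewrite !index_mem.
set a := index l s in a_lt; set b := index r s in b_lt.
have la : l = s`_a by rewrite nth_index.
have rb : r = s`_b by rewrite nth_index.
have s_gt0 : (0 < size s)%N by apply: leq_trans a_lt.
have icoE (k : 'I_(size s).-1) : ico l r s`_k = ((a <= k) && (k < b))%N%:R.
  have ks : (k < size s)%N by apply: leq_trans (ltn_ord k) (leq_pred _).
  by rewrite /ico la rb lt_sorted_leq_nth ?inE// lt_sorted_ltn_nth ?inE.
under eq_bigr => k _ do rewrite icoE.
have [ab|/ltnW ba] := leqP a b; last first.
  rewrite big1 => [|k _]; last first.
    case: andP => [[ak kb]|]; last by rewrite mulr0.
    by have := leq_trans (leq_ltn_trans ak kb) ba; rewrite ltnn.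
  apply/esym/max_idPl; rewrite subr_le0 la rb.
  by rewrite lt_sorted_leq_nth ?inE.
transitivity (\sum_(a <= k < b) (s`_k.+1 - s`_k)); last first.
  rewrite telescope_sumr// -la -rb; apply/esym/max_idPr; rewrite subr_ge0 la rb.
  by rewrite lt_sorted_leq_nth ?inE.
have bs : (b <= (size s).-1)%N by rewrite -ltnS prednK.
rewrite (big_nat_widen _ _ _ _ _ bs) (big_nat_widenl _ 0)// big_mkord [RHS]big_mkcond /=.
by apply: eq_bigr => k _; rewrite andbC; case: andP => _; rewrite ?mulr1 ?mulr0.
Qed.

(* Indicator of the arc [a, a + t) of the circle, parametrized by [-pi, pi):
   the part beyond [pi] wraps around to [-pi]. *)
Definition arc_ind {R : realType} (a t z : R) : R :=
  ico a (Num.min (a + t) pi) z +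
  ico (- pi) (Num.max (a + t - pi *+ 2) (- pi)) z.

Definition arc_ends {R : realType} (a t : R) : seq R :=
  [:: a; Num.min (a + t) pi; - pi; Num.max (a + t - pi *+ 2) (- pi)].

Lemma max_mem (R : realType) (s : seq R) (a b : R) :
  a \in s -> b \in s -> Num.max a b \in s.
Proof. by rewrite /Order.max; case: ifP. Qed.

Lemma min_mem (R : realType) (s : seq R) (a b : R) :
  a \in s -> b \in s -> Num.min a b \in s.
Proof. by rewrite /Order.min; case: ifP. Qed.

Lemma grid_sumD (R : realType) (s : seq R) (phi psi : R -> R) :
  grid_sum s (fun z => phi z + psi z) = grid_sum s phi + grid_sum s psi.
Proof. by rewrite /grid_sum -big_split; apply: eq_bigr => k _; rewrite mulrDr. Qed.

Lemma eq_grid_sum (R : realType) (s : seq R) (phi psi : R -> R) :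
  phi =1 psi -> grid_sum s phi = grid_sum s psi.
Proof. by move=> e; apply: eq_bigr => k _; rewrite e. Qed.

(** Distance on the circle between the points at angles [a] and [b] of [[- pi, pi]]: the shorter way
    round. *)
Definition circdist {R : realType} (a b : R) : R :=
  Num.min `|a - b| (pi *+ 2 - `|a - b|).

Definition hinge {R : realType} (t d : R) : R := Num.max 0 (t - d).

(* The left-hand side sums the overlaps of the two pieces of the wrapped arc at
   [a] with those of the arc at [b], with [pi] replaced by [p]. *)
Lemma arc_overlap (R : realDomainType) (a b t p : R) :
  0 <= t <= p -> - p <= a -> a <= b -> b <= p ->
  Num.max 0 (Num.min (Num.min (a + t) p) (Num.min (b + t) p) - Num.max a b) +
  Num.max 0
    (Num.min (Num.min (a + t) p) (Num.max (b + t - p *+ 2) (- p)) -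
     Num.max a (- p)) +
  (Num.max 0
     (Num.min (Num.max (a + t - p *+ 2) (- p)) (Num.min (b + t) p) -
      Num.max (- p) b) +
   Num.max 0
     (Num.min (Num.max (a + t - p *+ 2) (- p))
        (Num.max (b + t - p *+ 2) (- p)) -
      Num.max (- p) (- p))) =
  Num.max 0 (t - Num.min (b - a) (p *+ 2 - (b - a))).
Proof.
move=> /andP[t0 tp] pa ab bp; rewrite maxxx.
have pb : - p <= b by lra.
rewrite (max_idPl pa) (max_idPr ab) (max_idPr pb).
rewrite (@min_l _ _ (Num.min (a + t) p)); last by apply: le_min2; rewrite ?lerD2r.
rewrite (@min_l _ _ (Num.max (a + t - p *+ 2) (- p)) (Num.max _ _));
  last by apply: le_max2; lra.
(* As [t <= p], the wrapped piece of the arc at [a] ends no later than [b], so it misses the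
   unwrapped piece of the arc at [b]. *)
have -> : Num.max 0 (Num.min (Num.max (a + t - p *+ 2) (- p)) (Num.min (b + t) p) - b) = 0.
  by apply: max_l; rewrite subr_le0 ge_min ge_max; apply/orP; left; lra.
rewrite add0r.
have -> : Num.max 0 (Num.min (Num.min (a + t) p) (Num.max (b + t - p *+ 2) (- p)) - a) =
    Num.max 0 (b + t - p *+ 2 - a).
  have [h|h] := leP (b + t - p *+ 2) (- p).
    rewrite !max_l ?subr_le0 ?ge_min ?pa ?orbT//; lra.
  rewrite (@min_r _ _ (Num.min _ _)) // le_min; lra.
(* As [t <= p], at most one of the two terms on the right is positive, the one for the shorter way
   round. *)
have -> : Num.max 0 (t - Num.min (b - a) (p *+ 2 - (b - a))) =
    Num.max 0 (a + t - b) + Num.max 0 (b + t - p *+ 2 - a).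
  have [h|h] := leP (b - a) (p *+ 2 - (b - a)).
    rewrite [X in _ = _ + X]max_l ?addr0; first by congr Num.max; lra.
    lra.
  rewrite [X in _ = X + _]max_l ?add0r; first by congr Num.max; lra.
  lra.
(* The unwrapped pieces overlap up to [p], the wrapped ones in the part of the arc at [a] beyond
   [p]; together they make up the length from [b] to [a + t]. *)
rewrite addrAC; congr (_ + _).
have [h|h] := leP (a + t) p.
  by rewrite [X in _ + Num.max 0 (X - _)]max_r ?subrr ?maxxx ?addr0//; lra.
rewrite [X in _ + Num.max 0 (X - _)]max_l; last by lra.
rewrite !max_r; lra.
Qed.

(** Each arc is a union of two intervals, so the product expands into four interval overlaps, which
    [arc_overlap] adds up. *)
Lemma grid_sum_arc (R : realType) (s : seq R) (a b t : R) :
  sorted <%R s -> {subset arc_ends a t <= s} -> {subset arc_ends b t <= s} ->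
  - pi <= a <= pi -> - pi <= b <= pi -> 0 <= t <= pi ->
  grid_sum s (fun z => arc_ind a t z * arc_ind b t z) =
  hinge t (circdist a b).
Proof.
move=> s_sorted sa sb api bpi tpi; rewrite /hinge /circdist.
wlog ab : a b sa sb api bpi / a <= b => [hw|].
  have /orP[/hw|ba] := le_total a b; first exact.
  by rewrite distrC -(hw b a)//; apply: eq_grid_sum => z; rewrite mulrC.
have -> : `|a - b| = b - a by rewrite distrC ger0_norm ?subr_ge0.
have sa1 : a \in s by apply: sa; rewrite !inE eqxx.
have sa2 : Num.min (a + t) pi \in s by apply: sa; rewrite !inE eqxx !orbT.
have s3 : - pi \in s by apply: sa; rewrite !inE eqxx !orbT.
have sa4 : Num.max (a + t - pi *+ 2) (- pi) \in s by apply: sa; rewrite !inE eqxx !orbT.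
have sb1 : b \in s by apply: sb; rewrite !inE eqxx.
have sb2 : Num.min (b + t) pi \in s by apply: sb; rewrite !inE eqxx !orbT.
have sb4 : Num.max (b + t - pi *+ 2) (- pi) \in s by apply: sb; rewrite !inE eqxx !orbT.
under eq_grid_sum => z do rewrite mulrDl !mulrDr !ico_mul.
rewrite !grid_sumD !grid_sum_ico //; try by [apply: max_mem|apply: min_mem].
move/andP: api => [api _]; move/andP: bpi => [_ bpi].
exact: arc_overlap.
Qed.

(** * Angles of points of the circle *)

Lemma inner2E (R : realType) (x y : 'cV[R]_2) :
  inner2 x y = x 0 0 * y 0 0 + x 1 0 * y 1 0.
Proof.
rewrite /inner2 !mxE !big_ord_recl big_ord0 addr0 !mxE.
by rewrite (_ : lift ord0 ord0 = 1)//; apply/val_inj.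
Qed.

Lemma inner2_circle (R : realType) (x y : 'cV[R]_2) :
  circle x -> circle y -> -1 <= inner2 x y <= 1.
Proof.
rewrite /circle /= !inner2E => cx cy.
have := sqr_ge0 (x 0 0 - y 0 0); have := sqr_ge0 (x 1 0 - y 1 0).
have := sqr_ge0 (x 0 0 + y 0 0); have := sqr_ge0 (x 1 0 + y 1 0).
by move=> *; apply/andP; split; nra.
Qed.

Lemma geodist_itv (R : realType) (x y : 'cV[R]_2) :
  circle x -> circle y -> 0 <= geodist x y <= pi.
Proof. by move=> cx cy; rewrite acos_ge0 ?acos_lepi ?inner2_circle. Qed.

Lemma geodist_eq0 (R : realType) (x y : 'cV[R]_2) :
  circle x -> circle y -> geodist x y = 0 -> x = y.
Proof.
move=> cx cy d0.
have : cos (geodist x y) = inner2 x y by rewrite acosK ?in_itv/= ?inner2_circle.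
rewrite d0 cos0; move: cx cy.
rewrite /circle/= !inner2E => cx cy xy.
have /eqP : (x 0 0 - y 0 0) ^+ 2 + (x 1 0 - y 1 0) ^+ 2 = 0 by nra.
rewrite paddr_eq0 ?sqr_ge0// !sqrf_eq0 !subr_eq0 => /andP[/eqP e0 /eqP e1].
apply/matrixP => i j; rewrite (ord1 j).
have [->|->] : i = 0 \/ i = 1 by case: i => [[|[|//]] ?]; [left|right]; apply/val_inj.
all: by [].
Qed.

Definition det2 {R : realType} (x y : 'cV[R]_2) : R := x 0 0 * y 1 0 - x 1 0 * y 0 0.

(** The signed angle from [x] to [y], a coordinate on the circle with origin [x]; the antipode of
    [x] gets [pi]. *)
Definition angle {R : realType} (x y : 'cV[R]_2) : R :=
  if det2 x y < 0 then - geodist x y else geodist x y.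

Lemma norm_angle (R : realType) (x y : 'cV[R]_2) :
  circle x -> circle y -> `|angle x y| = geodist x y.
Proof.
move=> cx cy; have /andP[d0 _] := geodist_itv R x y cx cy.
by rewrite /angle; case: ifP => _; rewrite ?normrN ger0_norm.
Qed.

Lemma angle_itv (R : realType) (x y : 'cV[R]_2) :
  circle x -> circle y -> - pi <= angle x y <= pi.
Proof.
move=> cx cy; rewrite -ler_norml norm_angle//.
by have /andP[_] := geodist_itv R x y cx cy.
Qed.

Lemma cos_angle (R : realType) (x y : 'cV[R]_2) :
  circle x -> circle y -> cos (angle x y) = inner2 x y.
Proof.
move=> cx cy; rewrite /angle; case: ifP => _; rewrite ?cosN acosK// in_itv/=;
  exact: inner2_circle.
Qed.

Lemma sin_angle (R : realType) (x y : 'cV[R]_2) :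
  circle x -> circle y -> sin (angle x y) = det2 x y.
Proof.
move=> cx cy.
have sd : sin (geodist x y) = `|det2 x y|.
  rewrite /geodist sin_acos ?inner2_circle// -sqrtr_sqr; congr Num.sqrt.
  move: cx cy; rewrite /circle/= !inner2E /det2 => cx cy.
  (* Replacing [1] by the product of the squared norms leaves Lagrange's identity. *)
  have -> : 1 = (x 0 0 * x 0 0 + x 1 0 * x 1 0) * (y 0 0 * y 0 0 + y 1 0 * y 1 0).
    by rewrite cx cy mulr1.
  ring.
rewrite /angle; case: ltP => [d|d]; rewrite ?sinN sd; first by rewrite ltr0_norm ?opprK.
by rewrite ger0_norm.
Qed.

Lemma acos_cosB (R : realType) (a b : R) :
  - pi <= a <= pi -> - pi <= b <= pi -> acos (cos (a - b)) = circdist a b.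
Proof.
move=> /andP[a1 a2] /andP[b1 b2]; rewrite /circdist.
rewrite -cos_norm.
have : 0 <= `|a - b| <= pi *+ 2.
  rewrite normr_ge0/= ler_norml; apply/andP; split; lra.
move: `|a - b| => d /andP[d0 d2].
have [dpi|dpi] := leP d pi.
  rewrite cosK ?in_itv/= ?d0//; apply/esym/min_l; lra.
rewrite min_r; last by lra.
have -> : cos d = cos (pi *+ 2 - d) by rewrite addrC cosD2pi cosN.
rewrite cosK// in_itv/=; apply/andP; split; lra.
Qed.

(** The cosine of the difference of the angles is [inner2 x y * inner2 x z + det2 x y * det2 x z],
    which equals [inner2 x x * inner2 y z]. *)
Lemma geodist_angle (R : realType) (x y z : 'cV[R]_2) :
  circle x -> circle y -> circle z ->
  geodist y z = circdist (angle x y) (angle x z).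
Proof.
move=> cx cy cz; rewrite -acos_cosB ?angle_itv//; congr acos.
rewrite cosB !cos_angle// !sin_angle//; move: cx; rewrite /circle/= !inner2E /det2 => cx.
rewrite -[LHS]mul1r -cx; ring.
Qed.

(** * Quadratic forms of hinges *)

Lemma qformE (R : realType) (g : R -> R) (n : nat) (x : 'I_n -> 'cV[R]_2) (c : 'cV[R]_n) :
  qform (distmx g x) c =
  \sum_i \sum_j c i 0 * c j 0 * g (geodist (x i) (x j)).
Proof.
rewrite /qform mxE exchange_big /=; apply: eq_bigr => j _; rewrite mxE mulr_suml.
by apply: eq_bigr => i _; rewrite !mxE mulrAC.
Qed.

Lemma sorted_gap (R : realType) (s : seq R) (k : nat) (e : R) :
  sorted <%R s -> (k.+1 < size s)%N -> e \in s -> (e <= s`_k) || (s`_k.+1 <= e).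
Proof.
move=> s_sorted ks es; have es' : (index e s < size s)%N by rewrite index_mem.
have -> : e = s`_(index e s) by rewrite nth_index.
by rewrite !lt_sorted_leq_nth ?inE// ?(ltnW ks)// leqNgt orbC orbN.
Qed.

Lemma grid_sum_sqr_ge0 (R : realType) (s : seq R) (phi : R -> R) :
  sorted <%R s -> 0 <= grid_sum s (fun z => phi z ^+ 2).
Proof.
move=> s_sorted; apply: sumr_ge0 => k _; rewrite mulr_ge0 ?sqr_ge0// subr_ge0.
have ks : (k.+1 < size s)%N by rewrite -ltn_predRL.
by rewrite lt_sorted_leq_nth ?inE// ltnW.
Qed.

(** All cells have positive width. The last breakpoint is excluded because no cell starts there. *)
Lemma grid_sum_sqr_eq0 (R : realType) (s : seq R) (phi : R -> R) (k : nat) :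
  sorted <%R s -> grid_sum s (fun z => phi z ^+ 2) = 0 ->
  (k.+1 < size s)%N -> phi s`_k = 0.
Proof.
move=> s_sorted s0 ks; have kN : (k < (size s).-1)%N by rewrite ltn_predRL.
have gap (j : 'I_(size s).-1) : 0 < s`_j.+1 - s`_j.
  have js : (j.+1 < size s)%N by rewrite -ltn_predRL.
  by rewrite subr_gt0 lt_sorted_ltn_nth ?inE// ltnW.
have /psumr_eq0P/(_ s0 (Ordinal kN) isT)/eqP :
    forall j : 'I_(size s).-1, true -> 0 <= (s`_j.+1 - s`_j) * phi s`_j ^+ 2.
  by move=> j _; rewrite mulr_ge0 ?sqr_ge0// ltW.
by rewrite mulf_eq0 gt_eqF//= ?sqrf_eq0 => [/eqP//|]; exact: gap (Ordinal kN).
Qed.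

Lemma sorted_grid (R : realType) (r : seq R) :
  exists2 s : seq R, sorted <%R s & s =i r.
Proof.
exists (sort <=%R (undup r)); first by rewrite sort_lt_sorted undup_uniq.
by move=> e; rewrite mem_sort mem_undup.
Qed.

(** Each entry is the integral of a product of two arc indicators; exchanging sums gives the
    integral of a square. The origin [x0] can be chosen freely. *)
Lemma qform_hinge (R : realType) (n : nat) (x0 : 'cV[R]_2) (x : 'I_n -> 'cV[R]_2)
    (c : 'cV[R]_n) (t : R) (s : seq R) :
  circle x0 -> (forall i, circle (x i)) -> 0 <= t <= pi -> sorted <%R s ->
  (forall i, {subset arc_ends (angle x0 (x i)) t <= s}) ->
  qform (distmx (hinge t) x) c =
  grid_sum s (fun z => (\sum_i c i 0 * arc_ind (angle x0 (x i)) t z) ^+ 2).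
Proof.
move=> cx0 cx tpi s_sorted sub; rewrite qformE.
under eq_bigr => i _ do under eq_bigr => j _ do
  rewrite (geodist_angle R x0)// -(grid_sum_arc R s) ?angle_itv// /grid_sum mulr_sumr.
under eq_bigr => i _ do rewrite exchange_big /=.
rewrite exchange_big /=; apply: eq_bigr => k _.
rewrite expr2 big_distrlr /= mulr_sumr; apply: eq_bigr => i _.
by rewrite mulr_sumr; apply: eq_bigr => j _; ring.
Qed.

Lemma arc_grid (R : realType) (n : nat) (a : 'I_n -> R) (t : R) :
  exists2 s : seq R, sorted <%R s &
    forall i, {subset arc_ends (a i) t <= s}.
Proof.
have [s s_sorted sE] := sorted_grid R (flatten [seq arc_ends (a i) t | i <- enum 'I_n]).
exists s => // i e ei; rewrite sE; apply/flattenP; exists (arc_ends (a i) t) => //.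
by apply/mapP; exists i => //; rewrite mem_enum.
Qed.

Lemma qform_hinge_ge0 (R : realType) (n : nat) (x : 'I_n -> 'cV[R]_2)
    (c : 'cV[R]_n) (t : R) :
  (forall i, circle (x i)) -> 0 <= t <= pi -> 0 <= qform (distmx (hinge t) x) c.
Proof.
(* An empty family offers no origin for the angles, but its form is an empty sum. *)
case: n x c => [|n] x c cx tpi; first by rewrite qformE big_ord0.
have [s s_sorted sub] := arc_grid R n.+1 (fun i => angle (x ord0) (x i)) t.
by rewrite (qform_hinge R n.+1 (x ord0) x c t s)// grid_sum_sqr_ge0.
Qed.

(** Meant for [z] the breakpoint preceding [0]. No interval may end at [0], so a jump there comes
    from a nonempty interval starting at [0]. *)
Lemma ico_jump (R : realType) (l r z : R) :
  z < 0 -> (l <= z) || (0 <= l) -> (r <= z) || (0 < r) ->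
  ico l r 0 - ico l r z = ((l == 0) && (0 < r))%:R.
Proof.
move=> z0 lz rz; rewrite /ico.
have [l0|l0|->] := ltgtP l 0; last by rewrite leNgt z0 subr0.
- move: lz; rewrite (leNgt 0 l) l0 orbF => ->/=.
  case/orP: rz => [rz|r0]; last by rewrite r0 (lt_trans z0 r0) subrr.
  by rewrite !ltNge rz (le_trans rz (ltW z0)) subrr.
- by rewrite [l <= z]leNgt (lt_trans z0 l0) subrr.
Qed.

(* The jump at 0 of the step function below comes from [x i0] alone: an arc
   ending there would start at a point at distance [t] from [x i0]. *)
Lemma qform_hinge_gt0 (R : realType) (n : nat) (x : 'I_n -> 'cV[R]_2)
    (c : 'cV[R]_n) (t : R) :
  injective x -> (forall i, circle (x i)) -> c != 0 -> 0 < t < pi ->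
  (forall i j, geodist (x i) (x j) != t) ->
  0 < qform (distmx (hinge t) x) c.
Proof.
move=> x_inj cx c0 /andP[t0 tpi] tD.
have [i0 ci0] : exists i, c i 0 != 0.
  apply/existsP; apply: contraNT c0 => /existsPn c0; apply/eqP/matrixP => i j.
  by rewrite (ord1 j) mxE; apply/eqP/negPn/c0.
have t_itv : 0 <= t <= pi by rewrite !ltW.
pose a i := angle (x i0) (x i).
have [s s_sorted sub] := arc_grid R n a t.
rewrite (qform_hinge R n (x i0) x c t s)//.
rewrite lt_neqAle grid_sum_sqr_ge0// andbT eq_sym.
(* If the integral vanished, the step function would be zero both at [0] and at the breakpoint
   before it, hence so would its jump [c i0 0]. *)
apply: contraNneq ci0 => /grid_sum_sqr_eq0 F0.
have a_eq0 i : (a i == 0) = (i == i0).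
  rewrite -normr_eq0 norm_angle//; apply/eqP/eqP => [/geodist_eq0 d0|->].
    by apply/esym/x_inj/d0.
  by rewrite /geodist (cx i0) acos1.
have ai0 : a i0 = 0 by apply/eqP; rewrite a_eq0.
have pi_gt0 : 0 < pi :> R by exact: pi_gt0.
have s0 : 0 \in s by apply: (sub i0); rewrite ai0 !inE eqxx.
have st : t \in s.
  by apply: (sub i0); rewrite /arc_ends ai0 add0r min_l ?(ltW tpi)// !inE eqxx orbT.
have spi : - pi \in s by apply: (sub i0); rewrite !inE eqxx !orbT.
have idx (e e' : R) : e \in s -> e' \in s -> e < e' -> (index e s < index e' s)%N.
  by move=> es es'; rewrite -[X in X < _](nth_index 0 es) -[X in _ < X](nth_index 0 es')
    lt_sorted_ltn_nth ?inE ?index_mem.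
(* The breakpoints [- pi] and [t] ensure that [0] is neither the first nor the last one. *)
have := idx _ _ spi s0; rewrite oppr_lt0 => /(_ pi_gt0).
have := idx _ _ s0 st t0; have := nth_index 0 s0.
have : (index t s < size s)%N by rewrite index_mem.
case: (index 0 s) => [//|m] ms sm mt _.
have ms1 : (m.+2 < size s)%N by exact: leq_ltn_trans ms.
have sm0 : s`_m < 0 by rewrite -{2}sm lt_sorted_ltn_nth ?inE// ltnW// ltnW.
have gap e : e \in s -> (e <= s`_m) || (0 <= e).
  by rewrite -{2}sm; apply: sorted_gap => //; exact: ltnW.
have gap' e : e \in s -> e != 0 -> (e <= s`_m) || (0 < e).
  by move=> es /negPf e0; rewrite -[0 < e]orFb -e0 eq_sym -le_eqVlt; apply: gap.
have jump i : arc_ind (a i) t 0 - arc_ind (a i) t s`_m = (i == i0)%:R.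
  have /andP[ai_ge ai_le] : - pi <= a i <= pi by apply: angle_itv.
  have ai_neq : a i + t != 0.
    apply: contraNneq (tD i0 i) => /(canRL (addrK _)); rewrite sub0r => ai.
    by rewrite -norm_angle// -/(a i) ai normrN ger0_norm// ltW.
  rewrite /arc_ind [- (ico _ _ _ + _)]opprD addrACA !ico_jump//; first last.
  - apply: gap'; first by apply: (sub i); rewrite !inE eqxx orbT.
    by rewrite /Order.min; case: ifP => // _; rewrite gt_eqF.
  - by apply: gap; apply: (sub i); rewrite inE eqxx.
  (* The wrapped piece ends before [0], since [a i <= pi] and [t < pi]. *)
  - apply: gap'; first by apply: (sub i); rewrite !inE eqxx !orbT.
    by rewrite lt_eqF// gt_max; apply/andP; split; lra.
  - by apply: gap.
  rewrite oppr_eq0 (gt_eqF pi_gt0)/= addr0 a_eq0.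
  by case: eqVneq => // ->; rewrite ai0 add0r lt_min t0 pi_gt0.
apply/eqP; transitivity (\sum_i c i 0 * (arc_ind (a i) t 0 - arc_ind (a i) t s`_m)).
  rewrite (bigD1 i0)//= jump eqxx mulr1 big1 ?addr0// => i /negPf ii0.
  by rewrite jump ii0 mulr0.
under eq_bigr => i _ do rewrite mulrBr.
have Fm1 := F0 m.+1 s_sorted ms1; rewrite sm in Fm1.
by rewrite sumrB [X in X - _]Fm1 [X in _ - X](F0 m s_sorted (ltnW ms1)) subrr.
Qed.

(** * Decomposition into hinges at the knots *)

Definition knot_slope {R : realType} (g : R -> R) (s : seq R) (k : nat) : R :=
  if (k.+1 < size s)%N then (g s`_k.+1 - g s`_k) / (s`_k.+1 - s`_k) else 0.

(* Slope jump at the knot of index [k.+1]; [knot_slope] is 0 past the last knot. *)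
Definition knot_weight {R : realType} (g : R -> R) (s : seq R) (k : nat) : R :=
  knot_slope g s k.+1 - knot_slope g s k.

(** Induction leftwards from the last knot. One step adds the same cell width to every active hinge,
    and the weights from [m] on telescope to [- knot_slope g s m]. *)
Lemma hinge_sum (R : realType) (g : R -> R) (s : seq R) (m : nat) :
  sorted <%R s -> (m < size s)%N -> g s`_(size s).-1 = 0 ->
  g s`_m = \sum_(k < (size s).-1) knot_weight g s k * hinge s`_k.+1 s`_m.
Proof.
move=> s_sorted ms gN.
have mN : (m <= (size s).-1)%N by case: (size s) ms.
transitivity (\sum_(m <= k < (size s).-1) knot_weight g s k * (s`_k.+1 - s`_m)); last first.
  rewrite (big_nat_widenl _ 0)// big_mkord big_mkcond/=; apply: eq_bigr => k _.
  have ks : (k.+1 < size s)%N by rewrite -ltn_predRL.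
  rewrite /hinge; case: leqP => mk.
    by rewrite max_r// subr_ge0 lt_sorted_leq_nth ?inE// leqW.
  by rewrite max_l ?mulr0// subr_le0 lt_sorted_leq_nth ?inE.
have [d mdN] : exists d, (m + d)%N = (size s).-1.
  by exists ((size s).-1 - m)%N; rewrite subnKC.
elim: d m mdN {ms mN} => [|d IH] m mdN.
  by move: gN; rewrite -mdN addn0 big_geq.
have mN : (m < (size s).-1)%N by rewrite -mdN addnS ltnS leq_addr.
have ms : (m.+1 < size s)%N by rewrite -ltn_predRL.
have gap : s`_m.+1 - s`_m != 0.
  by rewrite gt_eqF// subr_gt0 lt_sorted_ltn_nth ?inE// ltnW.
have wsum : \sum_(m <= k < (size s).-1) knot_weight g s k = - knot_slope g s m.
  have s_gt0 : (0 < size s)%N by exact: leq_ltn_trans ms.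
  have slopeN : knot_slope g s (size s).-1 = 0 by rewrite /knot_slope prednK ?ltnn.
  rewrite /knot_weight (telescope_sumr (knot_slope g s) (ltnW mN)).
  by rewrite slopeN sub0r.
transitivity (\sum_(m <= k < (size s).-1)
    (knot_weight g s k * (s`_k.+1 - s`_m.+1) + knot_weight g s k * (s`_m.+1 - s`_m))).
  rewrite big_split/= -mulr_suml wsum big_ltn// subrr mulr0 add0r -IH ?addSnnS//=.
  by rewrite /knot_slope ms mulNr divfK// opprB addrC subrK.
by apply: eq_bigr => k _; rewrite -mulrDr addrA subrK.
Qed.

Lemma qform_knots (R : realType) (g : R -> R) (n : nat) (x : 'I_n -> 'cV[R]_2)
    (c : 'cV[R]_n) (s : seq R) :
  sorted <%R s -> (forall i j, geodist (x i) (x j) \in s) ->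
  g s`_(size s).-1 = 0 ->
  qform (distmx g x) c =
  \sum_(k < (size s).-1) knot_weight g s k * qform (distmx (hinge s`_k.+1) x) c.
Proof.
move=> s_sorted xs gN; rewrite qformE.
under [RHS]eq_bigr => k _ do rewrite qformE mulr_sumr.
rewrite [RHS]exchange_big /=; apply: eq_bigr => i _.
under [RHS]eq_bigr => k _ do rewrite mulr_sumr.
rewrite [RHS]exchange_big /=; apply: eq_bigr => j _.
have ij : (index (geodist (x i) (x j)) s < size s)%N by rewrite index_mem.
have := hinge_sum R g s _ s_sorted ij gN; rewrite nth_index// => ->.
rewrite mulr_sumr.
by apply: eq_bigr => k _; rewrite mulrCA.
Qed.

(** * Convexity, support and signs of the weights *)

(** This is convexity at [b], the combination of [a] and [c] with weight [(c - b) / (c - a)] on [a],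
    after clearing denominators. *)
Lemma convex_slopes (R : realType) (D : set R) (g : R -> R) (a b c : R) :
  @convex_function R R^o D g -> a \in D -> c \in D -> a < b -> b < c ->
  (g b - g a) / (b - a) <= (g c - g b) / (c - b).
Proof.
move=> g_convex aD cD ab bc.
have ac : 0 < c - a by lra.
have l0 : 0 <= (c - b) / (c - a) by apply: divr_ge0; lra.
have l1 : (c - b) / (c - a) <= 1 by rewrite ler_pdivrMr// mul1r; lra.
have bE : (c - b) / (c - a) * a + (1 - (c - b) / (c - a)) * c = b.
  by field; rewrite gt_eqF.
have h : g b <= (c - b) / (c - a) * g a + (1 - (c - b) / (c - a)) * g c.
  by rewrite -[in leLHS]bE; exact: (g_convex (Itv01 l0 l1) a c aD cD).
rewrite ler_pdivrMr ?subr_gt0// mulrAC ler_pdivlMr ?subr_gt0//.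
rewrite -subr_ge0 -(pmulr_rge0 _ ac) in h; rewrite -subr_ge0.
by congr (0 <= _): h; field; rewrite gt_eqF.
Qed.

Lemma supp_near_pi (R : realType) (g : R -> R) :
  supp g `<=` `[0, pi[ ->
  exists2 b : R, 0 <= b < pi & forall t, b <= t <= pi -> g t = 0.
Proof.
move=> g_supp.
have /existsNP[B] : ~ supp g pi by move/g_supp; rewrite /= in_itv/= ltxx andbF.
move=> /not_implyP[/nbhs_ballP[e /= e0 eB] /set0P/negP/negPn/eqP B0].
have pi_gt0 : 0 < pi :> R by exact: pi_gt0.
(* Halving the radius fits the closed interval into the open ball around [pi]. *)
exists (Num.max 0 (pi - e / 2)).
  by rewrite le_max lexx gt_max pi_gt0/=; lra.
move=> t /andP[]; rewrite ge_max => /andP[t0 te] tpi; apply/eqP/negPn/negP => gt0.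
suff : ([set t | 0 <= t <= pi /\ g t != 0] `&` B) t by rewrite B0.
split; first by rewrite /= t0 tpi.
by apply: eB; rewrite /ball/= ger0_norm; lra.
Qed.

(** Slopes increase to the slope [0] on [[b, pi]], so the slope from [t] to [b] is at most [0],
    while [g b = 0]. *)
Lemma convex_supp_ge0 (R : realType) (g : R -> R) (t : R) :
  supp g `<=` `[0, pi[ -> @convex_function R R^o `[0, pi] g ->
  0 <= t <= pi -> 0 <= g t.
Proof.
move=> g_supp g_convex /andP[t0 tpi].
have [b /andP[b0 bpi] gb] := supp_near_pi R g g_supp.
have [bt|tb] := leP b t; first by rewrite gb ?bt.
have := convex_slopes R `[0, pi]%classic g t b pi g_convex.
rewrite !inE/= !in_itv/= t0 tpi lexx (ltW (pi_gt0 R)) => /(_ isT isT tb bpi).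
rewrite (gb b) ?(gb pi) ?lexx ?(ltW bpi)// subrr mul0r sub0r ler_pdivrMr ?subr_gt0// mul0r.
by rewrite oppr_le0.
Qed.

Lemma sorted_last (R : realType) (s : seq R) (e : R) :
  sorted <%R s -> e \in s -> {in s, forall y, y <= e} -> s`_(size s).-1 = e.
Proof.
move=> s_sorted es e_max; have ei : (index e s < size s)%N by rewrite index_mem.
have sN : ((size s).-1 < size s)%N by case: (size s) ei.
apply/eqP; rewrite eq_le e_max ?mem_nth//= -[X in X <= _](nth_index 0 es).
by rewrite lt_sorted_leq_nth ?inE// -ltnS prednK// (leq_ltn_trans _ ei).
Qed.

Lemma sorted_head (R : realType) (s : seq R) (e : R) :
  sorted <%R s -> e \in s -> {in s, forall y, e <= y} -> s`_0 = e.
Proof.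
move=> s_sorted es e_min; have ei : (index e s < size s)%N by rewrite index_mem.
have s0 : (0 < size s)%N by rewrite (leq_ltn_trans _ ei).
apply/eqP; rewrite eq_le e_min ?mem_nth// andbT -[X in _ <= X](nth_index 0 es).
by rewrite lt_sorted_leq_nth ?inE.
Qed.

(** Weights at inner knots are nonnegative by convexity. The last weight is minus the last slope,
    and there [g] descends from a nonnegative value to [0]. *)
Lemma knot_weight_ge0 (R : realType) (g : R -> R) (s : seq R) (k : nat) :
  supp g `<=` `[0, pi[ -> @convex_function R R^o `[0, pi] g ->
  sorted <%R s -> {in s, forall e, 0 <= e <= pi} -> g s`_(size s).-1 = 0 ->
  (k.+1 < size s)%N -> 0 <= knot_weight g s k.
Proof.
move=> g_supp g_convex s_sorted s_itv gN ks.
have lt_nth i j : (i < j < size s)%N -> s`_i < s`_j.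
  by move=> /andP[ij js]; rewrite lt_sorted_ltn_nth ?inE// (ltn_trans ij).
have skD j : (j < size s)%N -> s`_j \in (`[0, pi]%classic : set R).
  by move=> js; rewrite inE/= in_itv/= s_itv ?mem_nth.
rewrite /knot_weight /knot_slope ks; case: ltnP => ks2.
  rewrite subr_ge0; apply: convex_slopes g_convex _ _ _ _; rewrite ?skD ?lt_nth ?ltnSn//.
  exact: ltnW.
have kN : k.+1 = (size s).-1.
  by case: (size s) ks ks2 => //= m; rewrite !ltnS => k1 k2; apply/eqP; rewrite eqn_leq k1 k2.
rewrite kN gN -kN !sub0r mulNr opprK divr_ge0//.
  apply: (convex_supp_ge0 R g _ g_supp g_convex); apply: s_itv.
  exact: mem_nth (ltnW ks).
by rewrite subr_ge0 ltW// lt_nth// ltnSn.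
Qed.

(** * Choice and refinement of the knots *)

(** Otherwise [g] would follow its chord on every cell, and the inner knots would witness piecewise
    linearity. The conclusion says that the slopes on the two sides of [t] differ, with denominators
    cleared. *)
Lemma off_chord (R : realType) (a b : R) (g : R -> R) (s : seq R) :
  a < b -> ~ piecewise_linear_oo a b g ->
  sorted <%R s -> a \in s -> b \in s -> {in s, forall e, a <= e <= b} ->
  exists k t, [/\ (k.+1 < size s)%N, s`_k < t < s`_k.+1 &
    (t - s`_k) * (g s`_k.+1 - g t) != (s`_k.+1 - t) * (g t - g s`_k)].
Proof.
move=> ab nPL s_sorted sa sb s_itv; apply: contrapT => on_chord; apply: nPL.
have := sorted_last R s b s_sorted sb (fun e es => proj2 (andP (s_itv e es))).
have := sorted_head R s a s_sorted sa (fun e es => proj1 (andP (s_itv e es))).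
case: s s_sorted sa sb {s_itv} on_chord => [//|a' s] s_sorted _ sb on_chord /= a'a.
rewrite {a'}a'a in s_sorted sb on_chord *.
case/lastP: s s_sorted sb on_chord => [_|s b' s_sorted _ on_chord].
  by rewrite inE gt_eqF.
rewrite size_rcons -[X in nth _ X]rcons_cons nth_rcons /= ltnn eqxx => b'b.
rewrite {b'}b'b in s_sorted on_chord *.
exists s => // i i_s; set u := a :: rcons s b in s_sorted on_chord *.
have iu : (i.+1 < size u)%N by rewrite /= size_rcons !ltnS.
have gap : u`_i < u`_i.+1 by rewrite lt_sorted_ltn_nth ?inE// ltnW.
pose p := (g u`_i.+1 - g u`_i) / (u`_i.+1 - u`_i).
exists p, (g u`_i - p * u`_i) => t _ /andP[].
have pE : p * (u`_i.+1 - u`_i) = g u`_i.+1 - g u`_i by rewrite divfK// gt_eqF// subr_gt0.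
rewrite !le_eqVlt => /orP[/eqP <- _|ut]; first by rewrite addrC subrK.
move=> /orP[/eqP ->|tu].
  by rewrite addrCA -mulrBr pE addrC subrK.
apply: contrapT => /eqP gt; apply: on_chord; exists i, t; split; rewrite ?ut//.
apply: contra_neq gt => h.
apply: (@mulIf _ (u`_i.+1 - u`_i)); first by rewrite gt_eqF// subr_gt0.
rewrite addrCA -mulrBr mulrDl mulrAC pE; move: h.
move: (u`_i) (u`_i.+1) (g _) (g _) (g _) => *; lra.
Qed.

(** [s'] is known only through its members, so the neighbours of [t] are identified by applying
    [sorted_gap] to both lists. *)
Lemma sorted_insert (R : realType) (s s' : seq R) (k : nat) (t : R) :
  sorted <%R s -> sorted <%R s' -> s' =i t :: s -> (k.+1 < size s)%N ->
  s`_k < t < s`_k.+1 ->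
  exists j, [/\ (j.+2 < size s')%N, s'`_j = s`_k, s'`_j.+1 = t & s'`_j.+2 = s`_k.+1].
Proof.
move=> s_sorted s'_sorted s'E ks /andP[kt tk].
have mem e : e \in s -> e \in s' by rewrite s'E inE orbC => ->.
have ks' : s`_k \in s' by apply: mem; apply: mem_nth; exact: ltnW.
have k1s' : s`_k.+1 \in s' by apply: mem; apply: mem_nth.
have ts' : t \in s' by rewrite s'E inE eqxx.
have idx (e e' : R) : e \in s' -> e' \in s' -> e < e' -> (index e s' < index e' s')%N.
  move=> es es'; rewrite -[X in X < _](nth_index 0 es) -[X in _ < X](nth_index 0 es').
  by rewrite lt_sorted_ltn_nth ?inE ?index_mem.
have := idx _ _ ks' ts' kt; have := idx _ _ ts' k1s' tk; have := nth_index 0 ts'.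
have : (index (s`_k.+1)%R s' < size s')%N by rewrite index_mem.
case: (index t s') => [//|j] ms jt tm _.
have js : (j.+2 < size s')%N by exact: leq_ltn_trans ms.
have lt_nth i i' : (i < i' < size s')%N -> s'`_i < s'`_i'.
  by move=> /andP[ii' i's]; rewrite lt_sorted_ltn_nth ?inE// (ltn_trans ii').
have jlt : s'`_j < t by rewrite -jt lt_nth// ltnSn ltnW.
have ltj : t < s'`_j.+2 by rewrite -jt lt_nth// ltnSn.
have ins e : e \in s' -> e != t -> (e <= s`_k) || (s`_k.+1 <= e).
  by rewrite s'E inE => /orP[->//|es _]; exact: sorted_gap.
exists j; split=> //; apply/eqP; rewrite eq_le; apply/andP; split.
- have := ins s'`_j (mem_nth _ (ltnW (ltnW js))); rewrite lt_eqF// => /(_ isT)/orP[//|].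
  by move=> /(lt_le_trans tk)/(lt_trans jlt); rewrite ltxx.
- by have := sorted_gap R s' j _ s'_sorted (ltnW js) ks'; rewrite jt [t <= _]leNgt kt orbF.
- by have := sorted_gap R s' j.+1 _ s'_sorted js k1s'; rewrite jt [_ <= t]leNgt tk.
- have := ins s'`_j.+2 (mem_nth _ js); rewrite gt_eqF// => /(_ isT)/orP[|//].
  by move=> /(lt_le_trans ltj)/(lt_trans kt); rewrite ltxx.
Qed.

Lemma distance_knots (R : realType) (n : nat) (x : 'I_n -> 'cV[R]_2) :
  (forall i, circle (x i)) ->
  exists s : seq R, [/\ sorted <%R s, 0 \in s, pi \in s,
    {in s, forall e, 0 <= e <= pi} & forall i j, geodist (x i) (x j) \in s].
Proof.
move=> cx.
pose r := 0 :: pi :: [seq geodist (x ij.1) (x ij.2) | ij <- enum {: 'I_n * 'I_n}].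
have [s s_sorted sE] := sorted_grid R r.
exists s; split=> // [||e|i j]; rewrite sE ?inE ?eqxx ?orbT//.
  move=> /or3P[/eqP->|/eqP->|/mapP[ij _ ->]]; rewrite ?lexx ?pi_ge0 ?geodist_itv//.
by apply/or3P/Or33/mapP; exists (i, j); rewrite ?mem_enum.
Qed.

(** * Positive and strict positive definiteness *)

Lemma convex_posdef_circle (R : realType) (g : R -> R) :
  {within `[0, pi], continuous g} -> supp g `<=` `[0, pi[ ->
  @convex_function R R^o `[0, pi] g -> posdef_circle g.
Proof.
move=> g_cont g_supp g_convex; split=> // n x x_inj cx c.
have [s [s_sorted _ spi s_itv sx]] := distance_knots R n x cx.
have [b /andP[_ bpi] gb] := supp_near_pi R g g_supp.
have sN : s`_(size s).-1 = pi.
  by apply: sorted_last => // e /s_itv/andP[].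
have gN : g s`_(size s).-1 = 0 by rewrite sN gb ?lexx ?ltW.
rewrite (qform_knots R g n x c s s_sorted sx gN); apply: sumr_ge0 => k _.
have ks : (k.+1 < size s)%N by rewrite -ltn_predRL.
apply: mulr_ge0; first exact: knot_weight_ge0.
by apply: qform_hinge_ge0 => //; apply/s_itv/mem_nth.
Qed.

Lemma convex_strict_posdef_circle (R : realType) (g : R -> R) :
  {within `[0, pi], continuous g} -> supp g `<=` `[0, pi[ ->
  @convex_function R R^o `[0, pi] g -> ~ piecewise_linear_oo 0 pi g ->
  strict_posdef_circle g.
Proof.
move=> g_cont g_supp g_convex nPL; split=> // n x x_inj cx c c0.
have [s [s_sorted s0 spi s_itv sx]] := distance_knots R n x cx.
have [k [t [ks ktk off]]] := off_chord R 0 pi g s (pi_gt0 R) nPL s_sorted s0 spi s_itv.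
(* All distances are in [s], so [t] is none of them, as [qform_hinge_gt0] requires. *)
have ts : t \notin s.
  apply/negP => /(sorted_gap R s k t s_sorted ks); case/andP: ktk => kt tk.
  by rewrite !leNgt kt tk.
have t_itv : 0 < t < pi.
  case/andP: ktk => kt tk; apply/andP; split.
    by apply: le_lt_trans kt; have /andP[] := s_itv _ (mem_nth 0 (ltnW ks)).
  by apply: (lt_le_trans tk); have /andP[] := s_itv _ (mem_nth 0 ks).
have [s' s'_sorted s'E] := sorted_grid R (t :: s).
have [j [js sj sj1 sj2]] := sorted_insert R s s' k t s_sorted s'_sorted s'E ks ktk.
have s'_itv : {in s', forall e, 0 <= e <= pi}.
  move=> e; rewrite s'E inE => /orP[/eqP ->|/s_itv//].
  by case/andP: t_itv => /ltW -> /ltW ->.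
have s'x i i' : geodist (x i) (x i') \in s' by rewrite s'E inE sx orbT.
have [b /andP[_ bpi] gb] := supp_near_pi R g g_supp.
have sN : s'`_(size s').-1 = pi.
  by apply: sorted_last => // [|e /s'_itv/andP[]//]; rewrite s'E inE spi orbT.
have gN : g s'`_(size s').-1 = 0 by rewrite sN gb ?lexx ?ltW.
have jN : (j < (size s').-1)%N by rewrite ltn_predRL ltnW.
(* The term of index [j] is singled out: its hinge sits at knot [j.+1], which is [t]. *)
rewrite (qform_knots R g n x c s' s'_sorted s'x gN) (bigD1 (Ordinal jN))//=.
have w_ge0 i : (i.+1 < size s')%N -> 0 <= knot_weight g s' i.
  by move=> i_s; exact: knot_weight_ge0.
apply: ltr_pwDl; last first.
  apply: sumr_ge0 => i _; have i_s : (i.+1 < size s')%N by rewrite -ltn_predRL.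
  by rewrite mulr_ge0 ?w_ge0// qform_hinge_ge0// s'_itv ?mem_nth.
rewrite mulr_gt0//; last first.
  rewrite sj1 qform_hinge_gt0// => i i'.
  by apply: contraNneq ts => <-.
(* A zero weight would make the slopes on both sides of [t] equal, against [off]. *)
rewrite lt_neqAle (w_ge0 _ (ltnW js)) andbT eq_sym /knot_weight /knot_slope js (ltnW js).
rewrite sj sj1 sj2 subr_eq0; apply: contra_neqN off; case/andP: ktk => kt tk.
have [d1 d2] : s`_k.+1 - t != 0 /\ t - s`_k != 0 by rewrite !subr_eq0 !gt_eqF.
rewrite (eqr_div _ _ d1 d2) => /eqP h.
by rewrite [LHS]mulrC [RHS]mulrC h.
Qed.

Theorem theorem1p7 (R : realType) (f g : R -> R)
  (g_def : forall t : R, 0 <= t <= pi -> g t = f (cos t))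
  (g_cont : {within `[0, pi], continuous g})
  (g_supp : supp g `<=` `[0, pi[)
  (g_der0 : right_derivable g 0)
  (g_convex : @convex_function R R^o `[0, pi] g) :
  posdef_circle g /\
  (~ piecewise_linear_oo 0 pi g -> strict_posdef_circle g).
Proof.
split; first exact: convex_posdef_circle.
exact: convex_strict_posdef_circle.
Qed.
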